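(* Let $P$ be a simplicial $d$-polytope which is not a simplex, let $f_0$ be its number of vertices, and put $g_1=f_0-d-1$. Then for every integer $k\ge1$, $P$ has at most $$\binom{g_1+k}{g_1-1}+\binom{g_1+k-1}{g_1-1}$$ empty simplices of dimension $\le k$.
   Context: A simplicial $d$-polytope is the $d$-dimensional convex hull of finitely many points in $\mathbb R^d$ all of whose proper faces are simplices. An empty simplex of $P$ is a subset $S$ of the vertex set which is not (the vertex set of) a face of $P$ while every proper subset of $S$ is a face; its dimension is $|S|-1$. *)

(* Defs.v *)
From HB Require Import structures.
From mathcomp Require Import all_boot all_order all_algebra finmap.
From mathcomp Require Import all_classical all_reals convex.

Set Implicit Arguments.
Unset Strict Implicit.
Unset Printing Implicit Defensive.

Import Order.TTheory GRing.Theory Num.Theory.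

Local Open Scope classical_set_scope.
Local Open Scope ring_scope.

Definition convex_hull (R : realType) (E : lmodType R) (A : set E) : set E :=
  smallest (fun C : set E => @convex_set R E C) A.

Definition affinely_independent (R : realType) (E : lmodType R)
    (S : {fset E}) : Prop :=
  forall w : E -> R,
    \sum_(x <- S) w x = 0 -> \sum_(x <- S) w x *: x = 0 ->
    forall x, x \in S -> w x = 0.

(* The affine hull of A has dimension n; false when A is empty. *)
Definition has_affine_dim (R : realType) (E : lmodType R)
    (A : set E) (n : nat) : Prop :=
  (exists S : {fset E},
      [/\ [set` S] `<=` A, affinely_independent S & #|` S| = n.+1]) /\
  (forall S : {fset E},
      [set` S] `<=` A -> affinely_independent S -> (#|` S| <= n.+1)%N).

Definition is_polytope (R : realType) (E : lmodType R) (P : set E) : Prop :=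
  exists V : {fset E}, P = convex_hull [set` V].

Definition is_simplex (R : realType) (E : lmodType R) (P : set E) : Prop :=
  exists S : {fset E}, affinely_independent S /\ P = convex_hull [set` S].

(* l = 0 is allowed, so set0 (take b = 1) and P itself (take b = 0) are
   faces of P. *)
Definition is_face (R : realType) (E : lmodType R) (P F : set E) : Prop :=
  exists (l : {scalar E}) (b : R),
    (forall x, P x -> l x <= b) /\ F = [set x | P x /\ l x = b].

Definition vertices (R : realType) (E : lmodType R) (P : set E) : set E :=
  [set v | is_face P [set v]].

(* The empty set is a simplex here, so it is harmless that it counts among
   the faces F. *)
Definition simplicial_polytope (R : realType) (d : nat)
    (P : set 'rV[R]_d) : Prop :=
  [/\ is_polytope P, has_affine_dim P d &
      forall F, is_face P F -> F <> P -> is_simplex F].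

Definition is_face_vertex_set (R : realType) (E : lmodType R) (P : set E)
    (S : {fset E}) : Prop :=
  exists F, is_face P F /\ vertices F = [set` S].

Definition empty_simplex (R : realType) (E : lmodType R) (P : set E)
    (S : {fset E}) : Prop :=
  [/\ [set` S] `<=` vertices P,
      ~ is_face_vertex_set P S &
      forall T : {fset E}, (T `<` S)%fset -> is_face_vertex_set P T].

(* Main.v *)
From HB Require Import structures.
Require Import Defs.
From mathcomp Require Import all_boot all_order all_algebra finmap.
From mathcomp Require Import all_classical all_reals convex.
From mathcomp Require Import interval_inference topology normedtype derive.
From mathcomp Require Import ring lra.

(** Let p_1, ..., p_n be the vertices of P, and let U be the space of their
    affine dependencies: the vectors c with sum of the c_i equal to 0 and sum of
    the c_i p_i equal to 0.  Since P spans its d-dimensional space, U has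
    dimension n - d - 1 = g1, which is positive because P is not a simplex.

    Faces are read off from U.  By a theorem of the alternative
    ([stiemke_support]), if a set S of vertices is not a face, then U contains a
    nonzero c that is nonnegative off S: otherwise some affine functional
    vanishes on S and is positive at all other vertices.  As proper faces are
    simplices, no nonzero dependency is nonnegative off a proper face
    ([proper_face_no_dependency]).  So for an empty simplex S such a c exists,
    and every such c is strictly negative on all of S, because the proper
    subsets of S are proper faces: empty simplices are minimal negative supports
    of elements of U.  Moreover one can choose c strictly positive off S
    ([empty_simplex_interior_dependency]).

    Fix a vertex i0 and treat separately the empty simplices that avoid i0 and
    those that contain it.  In the first case scale c so that c_i0 = 1, in the
    second so that c_i0 = -1.  Fix a Euclidean norm on U, and for each S let u_S
    be the point of least norm among the dependencies with this value at i0
    that are nonnegative off S.  Let q_S be the product of the coordinate forms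
    u |-> u_i, for i in S other than i0, padded with the form of i0 to a common
    degree m.  Then q_S(u_S) is nonzero.  If S and T differ and |u_S| <= |u_T|,
    then q_S(u_T) = 0: otherwise u_T has no zero coordinate at the indices of S,
    so u_S is nonnegative wherever u_T is zero, a short move from u_T towards
    u_S stays feasible for T, and it decreases the norm.  Hence the q_S are
    linearly independent forms of degree m in g1 variables, and there are at
    most binomial(m + g1 - 1, m) of them
    ([card_minimal_negative_supports], [triangular_products_bound]).  The
    factor of i0 is omitted from q_S, so m = k + 1 serves when S avoids i0 and
    m = k when S contains i0.  The two binomials of the statement are the bounds
    for the two cases. *)

Set Implicit Arguments.
Unset Strict Implicit.
Unset Printing Implicit Defensive.

Import Order.TTheory GRing.Theory Num.Theory.
Import numFieldNormedType.Exports.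
Local Open Scope ring_scope.

(** * Theorems of the alternative *)

(** Strict inequalities survive a short move in any direction.  The bound
    [e < 1] keeps a move from [x] towards [y] inside the segment. *)
Lemma small_step (F : realFieldType) (T : finType) (Z : pred T) (f g : T -> F) :
  (forall i, Z i -> 0 < f i) ->
  exists e, [/\ 0 < e, e < 1 & forall i, Z i -> 0 < f i + e * g i].
Proof.
move=> fpos; pose b i := f i / (1 + `|g i|).
have g1 i : 0 < 1 + `|g i| by rewrite ltr_pwDl.
pose e := \big[Order.min/2^-1]_(i | Z i) b i; exists e.
have e0 : 0 < e.
  rewrite /e; elim/big_ind: _ => [|x y x0 y0|i /fpos fi]; last exact: divr_gt0.
    by rewrite invr_gt0.
  by rewrite lt_min x0.
split=> //.
  apply: le_lt_trans (_ : 2^-1 < 1); last by lra.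
  by apply: bigmin_le_id.
move=> i Zi; have : e <= b i by exact: bigmin_le_cond.
rewrite ler_pdivlMr //; have := ler_norm (- g i); rewrite normrN.
nra.
Qed.

Lemma separating_covector (F : fieldType) m k (W : 'M[F]_(k, m)) (a : 'rV_m) :
  ~~ (a <= W)%MS -> exists z : 'cV_m, W *m z = 0 /\ (a *m z) 0 0 = 1.
Proof.
rewrite submxE => /matrix0Pn[i [j]]; rewrite (ord1 i) => aj0.
set e := (a *m cokermx W) 0 j in aj0.
exists (e^-1 *: col j (cokermx W)); rewrite -!scalemxAr colE.
rewrite (mulmxA W) (mulmxA a) mulmx_coker.
by rewrite mul0mx scaler0; split=> //; rewrite -colE 2!mxE -/e mulVf.
Qed.

(** Gordan's alternative relative to a subspace.  Working modulo the row space
    of [W] makes an induction on [Z] possible: when the functional found for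
    [Z :\ i0] is nonpositive at [a i0], the induction hypothesis is used again
    with [a i0] adjoined to [W].  If this yields a combination of the other
    vectors lying in the enlarged space, then the functional forces its
    coefficient on [a i0] to have the sign that allows moving [a i0] to the
    left-hand side. *)
Lemma gordan_mod (F : realFieldType) m k n (W : 'M[F]_(k, m))
    (a : 'I_n -> 'rV[F]_m) (Z : {set 'I_n}) :
  (exists y : 'cV_m, W *m y = 0 /\ forall i, i \in Z -> 0 < (a i *m y) 0 0) \/
  (exists c : 'I_n -> F, [/\ forall i, i \in Z -> 0 <= c i,
     exists2 i, i \in Z & 0 < c i & ((\sum_(i in Z) c i *: a i)%R <= W)%MS]).
Proof.
have [p] := ubnP #|Z|; elim: p => // p IH in k W Z *; rewrite ltnS => leZp.
have [->|[i0 i0Z]] := set_0Vmem Z.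
  by left; exists 0; rewrite mulmx0; split=> // i; rewrite inE.
have ltZ' : (#|Z :\ i0| < p)%N by rewrite (cardsD1 i0 Z) i0Z in leZp.
have extend c0 c (k' : nat) (W' : 'M_(k', m)) : 0 <= c0 ->
    (forall i, i \in Z :\ i0 -> 0 <= c i) ->
    (exists2 i, i \in Z :\ i0 & 0 < c i) \/ 0 < c0 ->
    ((c0 *: a i0 + \sum_(i in Z :\ i0) c i *: a i)%R <= W')%MS ->
  exists c : 'I_n -> F, [/\ forall i, i \in Z -> 0 <= c i,
     exists2 i, i \in Z & 0 < c i & ((\sum_(i in Z) c i *: a i)%R <= W')%MS].
  move=> c00 cge0 cpos cW; exists (fun i => if i == i0 then c0 else c i); split.
  - by move=> i iZ; case: eqP => // /eqP ii0; apply: cge0; rewrite !inE ii0.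
  - case: cpos => [[i]|c0pos]; last by exists i0; rewrite ?eqxx.
    by rewrite !inE => /andP[/negPf ii0 iZ] ci; exists i; rewrite ?ii0.
  - rewrite (big_setD1 i0) //= eqxx.
    under eq_bigr => i do [rewrite !inE => /andP[/negPf ii0 _]; rewrite ii0].
    exact: cW.
have [[y [Wy ypos]]|[c [cge0 cpos cW]]] := IH _ W _ ltZ'; last first.
  by right; apply: (extend 0 c); rewrite ?scale0r ?add0r //; left.
have [yi0|yi0] := ltP 0 ((a i0 *m y) 0 0).
  left; exists y; split=> // i iZ; have [->//|ii0] := eqVneq i i0.
  by apply: ypos; rewrite !inE ii0.
have [ai0W|/separating_covector[z [Wz az]]] := boolP (a i0 <= W)%MS.
  right; apply: (extend 1 (fun=> 0)); rewrite ?ler01 ?ltr01 //; last first.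
    by rewrite big1 ?addr0 ?scale1r // => i _; rewrite scale0r.
  by right.
have [[y' [Wy' y'pos]]|[c [cge0 cpos cW]]] := IH _ (col_mx W (a i0)) _ ltZ'.
  left; move: Wy'; rewrite mul_col_mx -[RHS]vsubmxK !linear0.
  move=> /eq_col_mx[Wy' ay'].
  (* z is positive at a i0; a small multiple of it spoils no other sign *)
  have [e [e0 _ He]] := @small_step F _ (mem (Z :\ i0))
    _ (fun i => (a i *m z) 0 0) y'pos.
  exists (y' + e *: z); split.
    by rewrite mulmxDr Wy' -scalemxAr Wz scaler0 addr0.
  move=> i iZ; rewrite mulmxDr -scalemxAr mxE [X in _ + X]mxE.
  have [->|ii0] := eqVneq i i0; last by apply: He; rewrite !inE ii0.
  by rewrite ay' az mxE add0r mulr1.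
right; have /submxP[D] := cW.
rewrite -[D]hsubmxK mul_row_col [rsubmx D]mx11_scalar mul_scalar_mx.
set d : F := rsubmx D 0 0 => cE.
have dneg : d <= 0.
  have : 0 < ((\sum_(i in Z :\ i0) c i *: a i) *m y) 0 0.
    rewrite mulmx_suml summxE; case: cpos => i1 i1Z ci1.
    rewrite (bigD1 i1) //= -scalemxAl mxE ltr_pwDl ?mulr_gt0 ?ypos //.
    apply: sumr_ge0 => i /andP[iZ _]; rewrite -scalemxAl mxE.
    by rewrite mulr_ge0 ?cge0 // ltW // ypos.
  rewrite cE mulmxDl -mulmxA Wy mulmx0 add0r -scalemxAl mxE.
  by move=> H; rewrite leNgt; apply/negP => d0; rewrite pmulr_rgt0 // ltNge yi0 in H.
apply: (extend (- d) c); rewrite ?oppr_ge0 //; first by left.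
by rewrite cE addrCA scaleNr addNr addr0 submxMl.
Qed.

(** The alternative in the form used below.  When the rows of [A] are points
    with a coordinate 1 prepended, [y] is an affine functional exposing the
    points of [S], and [c] is an affine dependency showing that [S] cannot be
    exposed. *)
Lemma stiemke_support (F : realFieldType) m n (A : 'M[F]_(n, m))
    (S : {set 'I_n}) :
  (exists y : 'cV_m, forall i,
     if i \in S then (A *m y) i 0 = 0 else 0 < (A *m y) i 0) \/
  (exists c : 'rV_n, [/\ c *m A = 0, forall i, i \notin S -> 0 <= c 0 i &
     exists2 i, i \notin S & 0 < c 0 i]).
Proof.
have rowy (y : 'cV_m) i : (row i A *m y) 0 0 = (A *m y) i 0.
  by rewrite -row_mul mxE.
pose W := \matrix_i (if i \in S then row i A else 0).
have [[y [Wy ypos]]|[c [cge0 [i0 i0S ci0] /submxP[D cD]]]] :=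
    @gordan_mod F m n n W (fun i => row i A) (~: S).
  left; exists y => i; case: ifP => iS; last by rewrite -rowy ypos // inE iS.
  have := congr1 (row i) Wy; rewrite row_mul rowK iS row0 => /matrixP/(_ 0 0).
  by rewrite rowy [RHS]mxE.
right; exists (\row_i (if i \in S then - D 0 i else c i)); split.
- rewrite mulmx_sum_row (bigID (mem S)) /=.
  under eq_bigr => i iS do rewrite mxE iS scaleNr.
  rewrite sumrN; apply/eqP; rewrite addrC subr_eq0; apply/eqP.
  transitivity (D *m W).
    rewrite -cD; apply: eq_big => i; first by rewrite inE.
    by move=> /negPf iS; rewrite mxE iS.
  rewrite mulmx_sum_row (bigID (mem S)) /= [X in _ + X]big1 ?addr0.
    by apply: eq_bigr => i iS; rewrite rowK iS.
  by move=> i /negPf iS; rewrite rowK iS scaler0.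
- by move=> i /[dup] iS /negPf iS'; rewrite mxE iS' cge0 // inE.
- by move: i0S; rewrite inE => iS; exists i0 => //; rewrite mxE (negPf iS).
Qed.

(** * Triangular families of products of linear forms *)

(** The functions [x |-> \prod_j x *m L s j] are forms of degree [m] in [g.+1]
    variables.  Evaluated at the points [u t], they give a nonsingular matrix:
    in a vanishing combination of its rows, look at the column of an index with
    nonzero coefficient and largest [f].  This matrix factors through the space
    of monomials of degree [m], and monomials correspond to sorted [m]-tuples of
    variables. *)
Lemma triangular_products_bound (F : realFieldType) (T : finType) (g m : nat)
    (L : T -> 'I_m -> 'cV[F]_g.+1) (u : T -> 'rV[F]_g.+1) (f : T -> F) :
  (forall t j, (u t *m L t j) 0 0 != 0) ->
  (forall s t, s != t -> f s <= f t -> exists j, (u t *m L s j) 0 0 = 0) ->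
  (#|T| <= 'C(m + g, m))%N.
Proof.
move=> diag tri.
pose M := \matrix_(s < #|T|, t < #|T|)
  \prod_j (u (enum_val t) *m L (enum_val s) j) 0 0.
pose D := [set t : m.-tuple 'I_g.+1 | sorted leq (map val t)].
(* the monomial of the choice h of one variable in each factor *)
pose srt (h : {ffun 'I_m -> 'I_g.+1}) : m.-tuple 'I_g.+1 :=
  sort_tuple (relpre val leq) [tuple h i | i < m].
have srtD h : srt h \in D.
  by rewrite inE sorted_map; apply: sort_sorted => i j; apply: leq_total.
have MCX : M = (\matrix_(s < #|T|, k < #|D|) \sum_(h | srt h == enum_val k)
                 \prod_j L (enum_val s) j (h j) 0) *m
               (\matrix_(k < #|D|, t < #|T|)
                 \prod_(i <- enum_val k) u (enum_val t) 0 i).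
  apply/matrixP => s t; rewrite !mxE.
  under eq_bigr => j _ do rewrite mxE.
  rewrite bigA_distr_bigA (partition_big srt (mem D)) //=.
  rewrite big_enum_val; apply: eq_bigr => k _; rewrite !mxE mulr_suml.
  apply: eq_bigr => h /eqP <-; rewrite big_split mulrC; congr (_ * _).
  by rewrite (perm_big _ (permEl (perm_sort _ _))) big_map big_enum.
have freeM : row_free M.
  apply: inj_row_free => c cM0; apply/eqP/negPn/negP => /matrix0Pn[i0 [s0]].
  rewrite (ord1 i0) => cs0.
  (* all other rows with nonzero coefficient vanish in column t *)
  have [t ct tmax] := @Order.TotalTheory.arg_maxP _ _ _ s0 (fun s => c 0 s != 0)
    (fun s => f (enum_val s)) cs0.
  have /rowP/(_ t) := cM0; rewrite !mxE (bigD1 t) //= big1 ?addr0 => [|s st].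
    move/eqP; rewrite mulf_eq0 (negPf ct) mxE => /prodf_eq0[j _].
    by rewrite (negPf (diag _ _)).
  have [->|cs] := eqVneq (c 0 s) 0; first by rewrite mul0r.
  have [||j Lj] := tri (enum_val s) (enum_val t); last 1 first.
  - by rewrite mxE (bigD1 j) //= Lj mul0r mulr0.
  - by rewrite (inj_eq enum_val_inj).
  - exact: tmax.
rewrite -card_sorted_tuples -/D -(eqP freeM) MCX.
exact: mulmx_max_rank.
Qed.

(** * Points of least norm and minimal negative supports *)

Local Open Scope classical_set_scope.
Local Open Scope card_scope.
Local Open Scope ring_scope.

Definition sqnorm (F : realFieldType) n (x : 'rV[F]_n) : F := \sum_i x 0 i ^+ 2.

(** Strict convexity of the square norm: the last term is the gain at an
    interior point of the segment. *)
Lemma sqnorm_segment (F : realFieldType) n (x y : 'rV[F]_n) e :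
  sqnorm (x + e *: (y - x)) =
  (1 - e) * sqnorm x + e * sqnorm y - e * (1 - e) * sqnorm (y - x).
Proof.
rewrite /sqnorm !mulr_sumr -sumrN -!big_split /=; apply: eq_bigr => i _.
by rewrite !mxE; ring.
Qed.

Lemma sqnorm_gt0 (F : realFieldType) n (x : 'rV[F]_n) : x != 0 -> 0 < sqnorm x.
Proof.
move=> /matrix0Pn[i [j]]; rewrite (ord1 i) => xj.
rewrite /sqnorm (bigD1 j) //= ltr_pwDl ?exprn_even_gt0 //.
by apply: sumr_ge0 => k _; apply: sqr_ge0.
Qed.

Lemma sqnorm_continuous (R : realType) n : continuous (@sqnorm R n).
Proof.
apply: continuous_big => [|i _]; first exact: add_continuous.
by move=> x; apply: continuousM; apply: coord_continuous.
Qed.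

Lemma mulmx_coord_continuous (R : realType) g n (B : 'M[R]_(g, n)) i :
  continuous (fun x : 'rV[R]_g => (x *m B) 0 i).
Proof.
under eq_fun do rewrite mxE.
apply: continuous_big => [|j _]; first exact: add_continuous.
move=> x; apply: continuousM; [exact: coord_continuous | exact: cst_continuous].
Qed.

(** The set need not be bounded; cutting it with a ball through one of its
    points makes it compact. *)
Lemma least_sqnorm (R : realType) n (K : set 'rV[R]_n) :
  closed K -> K !=set0 ->
  exists x, K x /\ forall y, K y -> sqnorm x <= sqnorm y.
Proof.
move=> clK [z Kz].
pose A := K `&` (@sqnorm R n @^-1` [set t | t <= sqnorm z]).
have clA : closed A.
  apply: closedI => //; apply: preimage_closed; last exact: closed_le.
  by move=> x _; apply: sqnorm_continuous.
have bA : bounded_set A.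
  exists (1 + sqnorm z); split; first exact: num_real.
  move=> M ltM x [_ /= xz]; apply/ltW/(le_lt_trans _ ltM).
  rewrite [leLHS]/Num.norm /= mx_normrE; apply/bigmax_leP; split=> [|[i j] _ /=].
    by rewrite addr_ge0 // sumr_ge0 // => i _; apply: sqr_ge0.
  rewrite (ord1 i); have : x 0 j ^+ 2 <= sqnorm z.
    apply: le_trans xz; rewrite /sqnorm (bigD1 j) //= lerDl.
    by apply: sumr_ge0 => k _; apply: sqr_ge0.
  by rewrite -real_normK ?num_real //; nra.
have [||x] := EVT_min_rV _ (bounded_closed_compact bA clA) (f := @sqnorm R n).
- by exists z; split=> /=.
- exact/continuous_subspaceT/sqnorm_continuous.
- rewrite inE => -[Kx /= xz] xmin; exists x; split=> // y Ky.
  have [yz|/ltW zy] := leP (sqnorm y) (sqnorm z); last exact: le_trans zy.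
  by apply: xmin; rewrite inE; split.
Qed.

(** The combinatorial core.  The vectors [x *m B] form a linear space, and the
    members of [Fam] are index sets that occur as the negative support of every
    vector of the slice [(x *m B) 0 i0 = c] that is nonnegative off them.  Each
    member is represented by the least-norm vector of its slice.  The index
    [i0] costs no degree, since its coordinate is the nonzero constant [c]. *)
Lemma card_minimal_negative_supports (R : realType) (g m n : nat)
    (B : 'M[R]_(g.+1, n)) (i0 : 'I_n) (c : R) (Fam : {set {set 'I_n}}) :
  c != 0 ->
  (forall S, S \in Fam -> (#|S :\ i0| <= m)%N) ->
  (forall S, S \in Fam -> exists x : 'rV_g.+1,
     (x *m B) 0 i0 = c /\ forall i, i \notin S -> 0 <= (x *m B) 0 i) ->
  (forall S, S \in Fam -> forall x : 'rV_g.+1, (x *m B) 0 i0 = c ->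
     (forall i, i \notin S -> 0 <= (x *m B) 0 i) ->
     forall i, i \in S -> (x *m B) 0 i < 0) ->
  (#|Fam| <= 'C(m + g, m))%N.
Proof.
move=> c0 cardS exS negS.
pose K (S : {set 'I_n}) := [set x : 'rV[R]_g.+1 |
  (x *m B) 0 i0 = c /\ forall i, i \notin S -> 0 <= (x *m B) 0 i].
have clK S : closed (K S).
  rewrite (_ : K S = (fun x => (x *m B) 0 i0) @^-1` [set t | t = c] `&`
      \bigcap_(i in [set i | i \notin S])
        ((fun x => (x *m B) 0 i) @^-1` [set t | 0 <= t])); last first.
    by apply/seteqP; split=> x [].
  apply: closedI; last apply: closed_bigI => i _.
    apply: preimage_closed; last exact: closed_eq.
    by move=> x _; apply: mulmx_coord_continuous.
  apply: preimage_closed; last exact: closed_ge.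
  by move=> x _; apply: mulmx_coord_continuous.
pose T := {S | S \in Fam}.
have /boolp.choice[u uP] (s : T) : exists v, K (val s) v /\
    forall y, K (val s) y -> sqnorm v <= sqnorm y.
  apply: least_sqnorm; first exact: clK.
  exact: exS (valP s).
have uneg (s : T) i : (i \in val s) = ((u s *m B) 0 i < 0).
  have [[us0 uspos] _] := uP s; apply/idP/idP; first exact: (negS _ (valP s)).
  by apply: contraTT => /uspos; rewrite leNgt.
(* the default i0 pads the list of factors to length m *)
pose e (s : T) j := nth i0 (enum (val s :\ i0)) j.
have colB (x : 'rV_g.+1) i : (x *m col i B) 0 0 = (x *m B) 0 i.
  by rewrite colE mulmxA -colE mxE.
have -> : #|Fam| = #|{: T}| by rewrite card_sig.
apply: (@triangular_products_bound R T g m (fun s j => col (e s j) B) u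
  (fun s => sqnorm (u s))) => [s j|s t st le_st].
  rewrite colB /e; have [ltj|gej] := ltnP j (size (enum (val s :\ i0))).
    have := mem_nth i0 ltj; rewrite mem_enum !inE uneg => /andP[_].
    by move/lt_eqF ->.
  by rewrite nth_default //; have [[-> _] _] := uP s.
apply: contrapT => noj.
(* every factor of s is assumed to be nonzero at u t *)
have nz i : i \in val s -> i != i0 -> (u t *m B) 0 i != 0.
  move=> iS ii0; apply/negP => /eqP uti0; apply: noj.
  have iE : i \in enum (val s :\ i0) by rewrite mem_enum !inE ii0.
  have ltm : (index i (enum (val s :\ i0)) < m)%N.
    by apply: leq_trans (cardS _ (valP s)); rewrite cardE index_mem.
  by exists (Ordinal ltm); rewrite colB /e nth_index.
have [[ut0 utpos] utmin] := uP t; have [[us0 uspos] _] := uP s.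
have [eps [eps0 eps1 epsP]] := @small_step R _
  [pred i | (i \notin val t) && (0 < (u t *m B) 0 i)] (fun i => (u t *m B) 0 i)
  (fun i => ((u s - u t) *m B) 0 i) (fun i Hi => proj2 (andP Hi)).
have Kx : K (val t) (u t + eps *: (u s - u t)).
  have xE i : ((u t + eps *: (u s - u t)) *m B) 0 i =
      (u t *m B) 0 i + eps * ((u s - u t) *m B) 0 i.
    by rewrite mulmxDl -scalemxAl mxE [X in _ + X]mxE.
  have dE i : ((u s - u t) *m B) 0 i = (u s *m B) 0 i - (u t *m B) 0 i.
    by rewrite mulmxBl mxE [X in _ + X]mxE.
  split=> [|i it]; rewrite xE; first by rewrite dE us0 ut0 subrr mulr0 addr0.
  have := utpos i it; rewrite le_eqVlt => /orP[/eqP uti|uti]; last first.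
    by apply/ltW/epsP; rewrite /= it.
  rewrite dE -uti subr0 add0r mulr_ge0 ?(ltW eps0) //; apply: uspos.
  apply/negP => /nz; rewrite -uti eqxx; case: eqP => [ii0|_ /(_ isT)//].
  by move: c0; rewrite -ut0 -ii0 -uti eqxx.
have := utmin _ Kx; rewrite sqnorm_segment.
have : 0 < sqnorm (u s - u t).
  apply: sqnorm_gt0; rewrite subr_eq0; apply: contra_neq st => ust.
  by apply/val_inj/setP => i; rewrite !uneg ust.
have : 0 < eps * (1 - eps) by rewrite mulr_gt0 ?subr_gt0.
nra.
Qed.

(** * Convex hulls and faces *)

Lemma convex_setP (R : realType) (E : lmodType R) (C : set E) :
  @convex_set R E C <-> forall x y t, 0 <= t -> t <= 1 -> C x -> C y ->
    C (t *: x + (1 - t) *: y).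
Proof.
split=> [cC x y t t0 t1 Cx Cy | cC x y t].
  by have := cC x y (Itv01 t0 t1); rewrite !inE => /(_ Cx Cy).
by rewrite !inE => Cx Cy; apply: cC.
Qed.

Lemma convex_combination (R : realType) (E : lmodType R) (C : set E) n
    (p : 'I_n -> E) (w : 'I_n -> R) :
  @convex_set R E C -> (forall i, 0 <= w i) -> \sum_i w i = 1 ->
  (forall i, w i != 0 -> C (p i)) -> C (\sum_i w i *: p i).
Proof.
move=> /convex_setP cC w0 w1 Cp.
suff H (r : seq 'I_n) : 0 < \sum_(i <- r) w i ->
    C ((\sum_(i <- r) w i)^-1 *: \sum_(i <- r) w i *: p i).
  by have := H (index_enum _); rewrite w1 invr1 scale1r; apply.
elim: r => [|i r IH]; first by rewrite big_nil ltxx.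
rewrite !big_cons; set s := \sum_(j <- r) w j.
have s0 : 0 <= s by apply: sumr_ge0.
have [r0|rn0] := eqVneq s 0.
  rewrite r0 addr0 => wi; rewrite [X in _ + X]big_seq big1 ?addr0 => [|j jr].
    by rewrite scalerA mulVf ?scale1r ?gt_eqF //; apply: Cp; rewrite gt_eqF.
  have : \sum_(j <- r) w j == 0 by rewrite -/s r0.
  by rewrite psumr_eq0 // => /allP/(_ _ jr)/eqP ->; rewrite scale0r.
have sp : 0 < s by rewrite lt_neqAle eq_sym rn0.
have [->|wi0] := eqVneq (w i) 0.
  by rewrite scale0r !add0r => _; apply: IH.
move=> wis; have := cC _ _ (w i / (w i + s)) _ _ (Cp _ wi0) (IH sp).
rewrite divr_ge0 ?addr_ge0 // ler_pdivrMr // mul1r lerDl s0.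
rewrite scalerDr !scalerA => /(_ isT isT).
congr (C (_ *: _ + _ *: _)); first by rewrite mulrC.
by rewrite -/s; field; rewrite rn0 gt_eqF.
Qed.

Lemma convex_hull_range (R : realType) (E : lmodType R) n (p : 'I_n -> E) x :
  convex_hull (range p) x <->
  exists w : 'I_n -> R,
    [/\ forall i, 0 <= w i, \sum_i w i = 1 & x = \sum_i w i *: p i].
Proof.
split=> [|[w [w0 w1 ->]] C [cC pC]]; last first.
  by apply: convex_combination => // i _; apply: pC; exists i.
apply: (@smallest_sub _ _ _ [set x | exists w : 'I_n -> R,
    [/\ forall i, 0 <= w i, \sum_i w i = 1 & x = \sum_i w i *: p i]]); last first.
  move=> _ [i _ <-]; exists (fun j => (j == i)%:R); split=> //.
  - by rewrite (bigD1 i) //= eqxx big1 ?addr0 // => j /negPf ->.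
  - rewrite (bigD1 i) //= eqxx scale1r big1 ?addr0 // => j /negPf ->.
    by rewrite scale0r.
apply/convex_setP => _ _ t t0 t1 [w [w0 w1 ->]] [v [v0 v1 ->]].
exists (fun i => t * w i + (1 - t) * v i); split.
- by move=> i; rewrite addr_ge0 ?mulr_ge0 ?subr_ge0.
- by rewrite big_split /= -!mulr_sumr w1 v1; ring.
- rewrite !scaler_sumr -big_split /=; apply: eq_bigr => i _.
  by rewrite !scalerA -scalerDl.
Qed.

Lemma convex_hull_sub (R : realType) (E : lmodType R) (A C : set E) :
  @convex_set R E C -> A `<=` C -> convex_hull A `<=` C.
Proof. exact: smallest_sub. Qed.

Lemma sub_convex_hull (R : realType) (E : lmodType R) (A : set E) :
  A `<=` convex_hull A.
Proof. exact: sub_gen_smallest. Qed.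

Lemma convex_convex_hull (R : realType) (E : lmodType R) (A : set E) :
  @convex_set R E (convex_hull A).
Proof.
apply/convex_setP => x y t t0 t1 Ax Ay C [cC AC].
by have /convex_setP := cC; apply=> //; [apply: Ax|apply: Ay].
Qed.

Lemma convex_halfspace (R : realType) (E : lmodType R) (l : {scalar E}) b :
  @convex_set R E [set x | l x <= b].
Proof.
apply/convex_setP => x y t t0 t1 /= lx ly; rewrite linearD !linearZ /=.
by have := ler_wpM2l t0 lx; have : 0 <= 1 - t by [rewrite subr_ge0]; nra.
Qed.

(** Complementary slackness: when [l <= b] on the points that carry weight, a
    combination attaining the bound gives weight only to points attaining it.
    Slack is only required to be nonnegative after multiplication by the
    weight, so that signed dependencies are covered as well as convex
    combinations. *)
Lemma tight_support (R : realType) (E : lmodType R) n (p : 'I_n -> E)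
    (l : {scalar E}) b (w : 'I_n -> R) :
  (forall i, w i != 0 -> 0 <= w i * (b - l (p i))) ->
  l (\sum_i w i *: p i) = b * \sum_i w i ->
  forall i, w i != 0 -> l (p i) = b.
Proof.
move=> wl le i wi; have : \sum_i w i * (b - l (p i)) = 0.
  under eq_bigr => j do rewrite mulrBr.
  rewrite sumrB -mulr_suml mulrC -le linear_sum /=.
  by apply/eqP; rewrite subr_eq0; apply/eqP/eq_bigr => j _; rewrite linearZ.
have w0 j : true -> 0 <= w j * (b - l (p j)).
  by have [->|/wl//] := eqVneq (w j) 0; rewrite mul0r.
move/eqP; rewrite psumr_eq0 // => /allP/(_ i (mem_index_enum _)).
by rewrite mulf_eq0 (negPf wi) subr_eq0 => /eqP.
Qed.

(** A vertex of a face is a convex combination of generators.  Those with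
    positive weight lie on the face by complementary slackness, and a second
    application, to the functional exposing the vertex, shows that they equal
    the vertex. *)
Lemma vertices_face_sub_range (R : realType) (E : lmodType R) n (p : 'I_n -> E)
    (F : set E) :
  is_face (convex_hull (range p)) F -> vertices F `<=` range p.
Proof.
move=> [l [b [lb FE]]] v [l' [b' [lb' vE]]].
have [Fv lv] : F v /\ l' v = b' by have : [set v] v by []; rewrite vE.
have := Fv; rewrite FE => -[/convex_hull_range[w [w0 w1 vw]] lvb].
have tight i : w i != 0 -> l (p i) = b.
  apply: tight_support => [j _|]; last by rewrite w1 mulr1 -vw.
  by rewrite mulr_ge0 // subr_ge0 lb //; apply: sub_convex_hull; exists j.
have Fp i : w i != 0 -> F (p i).
  by move=> wi; rewrite FE; split; [apply: sub_convex_hull; exists i|exact: tight].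
have tight' i : w i != 0 -> l' (p i) = b'.
  apply: tight_support => [j wj|]; last by rewrite w1 mulr1 -vw.
  by rewrite mulr_ge0 // subr_ge0 lb' //; apply: Fp.
have [i wi] : exists i, w i != 0.
  apply: contrapT => noi; have : (1 : R) == 0.
    rewrite -w1 big1 // => i _; apply/eqP/negPn/negP => wi.
    by apply: noi; exists i.
  by rewrite oner_eq0.
exists i => //; have : [set v] (p i) by rewrite vE; split; [exact: Fp|exact: tight'].
by [].
Qed.

Lemma is_face_refl (R : realType) (E : lmodType R) (P : set E) : is_face P P.
Proof.
exists (\0 : {scalar E}), 0; split=> [x Px //|].
by apply/seteqP; split=> [x Px|x []//]; split.
Qed.

Lemma vertices_of_face (R : realType) (E : lmodType R) (P F : set E) v :
  is_face P F -> vertices P v -> F v -> vertices F v.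
Proof.
move=> [l [b [_ FE]]] [l' [b' [lb' vE]]] Fv; exists l', b'; split=> [x|].
  by rewrite FE => -[Px _]; apply: lb'.
apply/seteqP; split=> [x ->|x [Fx lx]].
  by split=> //; have : [set v] v by []; rewrite vE => -[].
by rewrite vE; split=> //; move: Fx; rewrite FE => -[].
Qed.

Lemma vertices_sub (R : realType) (E : lmodType R) (F : set E) :
  vertices F `<=` F.
Proof.
by move=> v [l [b [_ vE]]]; have : [set v] v by []; rewrite vE => -[].
Qed.

Lemma fset_enumeration (E : choiceType) (V : {fset E}) :
  exists p : 'I_#|` V| -> E, injective p /\ range p = [set` V].
Proof.
exists (tnth (in_tuple (enum_fset V))); split.
  by apply/tuple_uniqP; apply: fset_uniq.
apply/seteqP; split=> [_ [i _ <-]|x /= xV]; first exact: mem_tnth.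
by have /tnthP[i ->] : x \in in_tuple (enum_fset V) by []; exists i.
Qed.

Lemma simplex_vertices (R : realType) (E : lmodType R) (S : {fset E}) :
  vertices (convex_hull [set` S]) `<=` [set` S].
Proof.
have [p [_ <-]] := fset_enumeration S.
exact/vertices_face_sub_range/is_face_refl.
Qed.

(** * Affine dependencies and affine functionals *)

(** The sign turns an affine functional that is nonnegative on a polytope into
    an inequality [l <= b], as in the definition of a face. *)
Definition covector (R : realType) d (y : 'cV[R]_d) (x : 'rV[R]_d) : R :=
  - (x *m y) 0 0.

Fact covector_is_linear (R : realType) d (y : 'cV[R]_d) :
  GRing.linear_for *%R (covector y).
Proof.
by move=> a u v; rewrite /covector mulmxDl -scalemxAl mxE [X in X + _]mxE; ring.
Qed.

HB.instance Definition _ (R : realType) d (y : 'cV[R]_d) :=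
  GRing.isLinear.Build R 'rV[R]_d R *%R (covector y) (covector_is_linear y).

(** The coordinate 1 turns affine dependencies and affine functionals into
    linear ones. *)
Definition homog (R : realType) d (x : 'rV[R]_d) : 'rV[R]_(1 + d) := row_mx 1 x.

Lemma homog_covector (R : realType) d (y : 'cV[R]_(1 + d)) x :
  (homog x *m y) 0 0 = y 0 0 - covector (dsubmx y) x.
Proof.
rewrite /homog /covector -{1}[y]vsubmxK mul_row_col mul1mx mxE opprK.
by congr (_ + _); rewrite mxE; congr (y _ _); apply: val_inj.
Qed.

Lemma sum_homog (R : realType) d n (c : 'I_n -> R) (p : 'I_n -> 'rV[R]_d) :
  \sum_i c i *: homog (p i) = row_mx (\sum_i c i)%:M (\sum_i c i *: p i).
Proof.
rewrite /homog; under eq_bigr => i _ do rewrite scale_row_mx scalemx1.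
elim/big_rec3: _ => [|i x y z _ ->]; first by rewrite raddf0 row_mx0.
by rewrite add_row_mx raddfD.
Qed.

Definition homogenization (R : realType) d n (p : 'I_n -> 'rV[R]_d) : 'M[R]_(n, 1 + d) :=
  \matrix_i homog (p i).

Lemma dependencyP (R : realType) d n (p : 'I_n -> 'rV[R]_d) (c : 'rV[R]_n) :
  c *m homogenization p = 0 <-> \sum_i c 0 i = 0 /\ \sum_i c 0 i *: p i = 0.
Proof.
rewrite mulmx_sum_row; under eq_bigr => i _ do rewrite rowK.
rewrite sum_homog; split=> [|[-> ->]]; last by rewrite raddf0 row_mx0.
rewrite -[RHS]hsubmxK !linear0 => /eq_row_mx[s0 p0]; split=> //.
by have /matrixP/(_ 0 0) := s0; rewrite !mxE mulr1n.
Qed.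

Lemma homogenization_mul (R : realType) d n (p : 'I_n -> 'rV[R]_d)
    (y : 'cV[R]_(1 + d)) i :
  (homogenization p *m y) i 0 = (homog (p i) *m y) 0 0.
Proof.
have -> : homog (p i) = row i (homogenization p) by rewrite rowK.
by rewrite -row_mul [RHS]mxE.
Qed.

Lemma covector_face (R : realType) d n (p : 'I_n -> 'rV[R]_d) (y : 'cV_(1 + d)) :
  (forall i, 0 <= (homogenization p *m y) i 0) ->
  is_face (convex_hull (range p))
    [set x | convex_hull (range p) x /\ (homog x *m y) 0 0 = 0].
Proof.
move=> y0; exists (covector (dsubmx y) : {scalar _}), (y 0 0); split.
  apply: convex_hull_sub; first exact: convex_halfspace.
  by move=> _ [i _ <-] /=; rewrite -subr_ge0 -homog_covector -homogenization_mul.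
have faceE x : (homog x *m y) 0 0 = 0 <-> covector (dsubmx y) x = y 0 0.
  rewrite homog_covector; split=> [/eqP|->]; last by rewrite subrr.
  by rewrite subr_eq0 => /eqP.
by apply/seteqP; split=> x [Px /faceE lx].
Qed.

(** Affine independence is defined for weights on a finite set of points;
    dependencies are indexed families.  Summing coefficients over the fibres
    of [p] passes from one to the other. *)
Lemma affinely_independent_dependency (R : realType) (E : lmodType R)
    (S : {fset E}) n (p : 'I_n -> E) (c : 'I_n -> R) :
  injective p -> affinely_independent S ->
  (forall i, c i != 0 -> p i \in S) ->
  \sum_i c i = 0 -> \sum_i c i *: p i = 0 -> forall i, c i = 0.
Proof.
move=> injp indS cS c0 cp0 i; apply/eqP/negPn/negP => /[dup] ci /cS iS.
pose w x := \sum_(j | p j == x) c j.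
have sumS (V : lmodType R) (h : E -> V) :
    \sum_(x <- S) w x *: h x = \sum_j c j *: h (p j).
  under eq_bigr => x _ do rewrite scaler_suml.
  rewrite (exchange_big_dep xpredT) //=; apply: eq_bigr => j _.
  have [->|/cS jS] := eqVneq (c j) 0.
    by rewrite big1 ?scale0r // => x _; rewrite scale0r.
  rewrite big_mkcond (bigD1_seq (p j)) ?fset_uniq //= eqxx big1 ?addr0 //.
  by move=> x; rewrite eq_sym => /negPf ->.
have wp : w (p i) = c i.
  by rewrite /w (bigD1 i) //= big1 ?addr0 // => j /andP[/eqP/injp ->]; rewrite eqxx.
have : w (p i) = 0.
  apply: indS => //; last by rewrite (sumS _ id).
  transitivity (\sum_(x <- S) w x *: (1 : R^o)).
    by apply: eq_bigr => x _; rewrite [RHS]mulr1.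
  by rewrite sumS -[RHS]c0; apply: eq_bigr => j _; rewrite [LHS]mulr1.
by rewrite wp => /eqP; apply/negP.
Qed.

(** * Polytopes are the hulls of their vertices *)

(** Vertices are obtained below by discarding superfluous generators. *)
Lemma convex_hull_redundant (R : realType) (E : lmodType R) n
    (p : 'I_n.+1 -> E) i :
  convex_hull (range (p \o lift i)) (p i) ->
  convex_hull (range p) = convex_hull (range (p \o lift i)).
Proof.
move=> pi; apply/seteqP; split; apply: convex_hull_sub;
  try exact: convex_convex_hull.
  move=> _ [j _ <-]; have [k ->|->//] := unliftP i j.
  by apply: sub_convex_hull; exists k.
by move=> _ [j _ <-]; apply: sub_convex_hull; exists (lift i j).
Qed.

(** A dependency that is nonnegative off [i] is negative at [i], so solving it
    for [p i] gives a convex combination of the other points. *)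
Lemma redundant_point (R : realType) d n (p : 'I_n.+1 -> 'rV[R]_d) i
    (c : 'rV[R]_n.+1) :
  c *m homogenization p = 0 -> (forall j, j != i -> 0 <= c 0 j) ->
  (exists2 j, j != i & 0 < c 0 j) ->
  convex_hull (range (p \o lift i)) (p i).
Proof.
move=> /dependencyP[]; rewrite !(bigD1_ord i) //= => c0 cp0 cge [j0 j0i cj0].
pose s := \sum_(j < n) c 0 (lift i j).
have s0 : 0 < s.
  have [k j0k|j0E] := unliftP i j0; last by rewrite j0E eqxx in j0i.
  rewrite /s (bigD1 k) //= -j0k ltr_pwDl //; apply: sumr_ge0 => j _.
  by rewrite cge // eq_sym neq_lift.
have ci : c 0 i = - s by apply/eqP; rewrite -addr_eq0 c0.
apply/convex_hull_range; exists (fun j => c 0 (lift i j) / s); split.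
- by move=> j; rewrite divr_ge0 ?(ltW s0) // cge // eq_sym neq_lift.
- by rewrite -mulr_suml mulfV ?gt_eqF.
- under eq_bigr => j _ do rewrite mulrC -scalerA.
  rewrite -scaler_sumr; apply: (scalerI (lt0r_neq0 s0)).
  rewrite scalerA mulfV ?gt_eqF // scale1r; apply/eqP; rewrite -subr_eq0 -oppr_eq0.
  by rewrite opprB addrC -scaleNr -ci cp0.
Qed.

(** The face cut out by a functional that vanishes at one generator only is
    that generator, again by complementary slackness. *)
Lemma vertex_of_covector (R : realType) d n (p : 'I_n -> 'rV[R]_d) i
    (y : 'cV[R]_(1 + d)) :
  (forall j, if j \in [set i]%SET then (homogenization p *m y) j 0 = 0
             else 0 < (homogenization p *m y) j 0) ->
  vertices (convex_hull (range p)) (p i).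
Proof.
move=> yP; have y0 j : 0 <= (homogenization p *m y) j 0.
  by have := yP j; case: ifP => [_ ->//|_ /ltW].
have := covector_face y0; rewrite /vertices /=; congr is_face.
apply/seteqP; split=> [x [/convex_hull_range[w [w0 w1 ->]]]|_ ->]; last first.
  split; first by apply: sub_convex_hull; exists i.
  by rewrite -homogenization_mul; have := yP i; rewrite inE eqxx.
rewrite homog_covector => /eqP; rewrite subr_eq0 => /eqP ly /=.
have wz j : j != i -> w j = 0.
  move=> ji; apply/eqP/negPn/negP => wj.
  have := yP j; rewrite inE (negPf ji) homogenization_mul homog_covector.
  rewrite (@tight_support _ _ _ p (covector (dsubmx y)) (y 0 0) w _ _ j wj).
  - by rewrite subrr ltxx.
  - by move=> k _; rewrite mulr_ge0 // -homog_covector -homogenization_mul.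
  - by rewrite w1 mulr1 ly.
have wi : w i = 1.
  by rewrite -w1 (bigD1 i) //= big1 ?addr0 // => j /wz.
by rewrite (bigD1 i) //= big1 ?addr0 ?wi ?scale1r // => j /wz ->; rewrite scale0r.
Qed.

(** In a generating family of least size no point is redundant.  By the theorem
    of the alternative each point is then exposed, hence a vertex. *)
Lemma polytope_vertices (R : realType) d (P : set 'rV[R]_d) :
  is_polytope P -> exists n (p : 'I_n -> 'rV[R]_d),
    [/\ injective p, P = convex_hull (range p) & vertices P = range p].
Proof.
move=> [V PV].
pose gen n := `[< exists p : 'I_n -> 'rV[R]_d, P = convex_hull (range p) >].
have exgen : exists n, gen n.
  have [p [_ pV]] := fset_enumeration V.
  by exists #|` V|; apply/asboolP; exists p; rewrite pV.
case: (ex_minnP exgen) => n /asboolP[p Pp] nmin; exists n, p.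
case: n p => [|n] p in Pp nmin *.
  split=> //; first by case.
  apply/seteqP; split=> [|_ [[]]//].
  by rewrite Pp; apply/vertices_face_sub_range/is_face_refl.
have irred i : ~ convex_hull (range (p \o lift i)) (p i).
  move=> /convex_hull_redundant hE.
  suff /nmin : gen n by rewrite ltnn.
  by apply/asboolP; eexists; rewrite Pp hE.
split=> //.
  move=> i j pij; have [k jE|//] := unliftP i j.
  case: (irred i); apply: sub_convex_hull; exists k => //=.
  by rewrite -jE.
apply/seteqP; split.
  by rewrite Pp; apply/vertices_face_sub_range/is_face_refl.
move=> _ [i _ <-]; rewrite Pp.
have [[y /vertex_of_covector//]|[c [cA cge [j ji cj]]]] :=
  @stiemke_support _ _ _ (homogenization p) [set i]%SET.
case: (irred i); apply: redundant_point cA _ _.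
  by move=> k ki; apply: cge; rewrite inE.
by exists j; rewrite ?inE // in ji *.
Qed.

(** * Number of vertices and dimension *)

(** The points whose homogenization lies in a given row space form an affine
    space, in particular a convex set; it contains the hull as soon as it
    contains the generators.  So [d.+1] affinely independent points of the hull
    give [d.+1] independent vectors of the row space. *)
Lemma rank_homogenization (R : realType) d n (p : 'I_n -> 'rV[R]_d) :
  has_affine_dim (convex_hull (range p)) d -> \rank (homogenization p) = d.+1.
Proof.
move=> [[S [SP indS cardS]] _]; apply/eqP; rewrite eqn_leq rank_leq_col /=.
have [q [injq qS]] := fset_enumeration S; rewrite cardS in q injq qS.
have freeq : row_free (homogenization q).
  apply: inj_row_free => c /dependencyP[c0 cq0]; apply/rowP => i; rewrite mxE.
  apply: (affinely_independent_dependency injq indS) c0 cq0 i => j _.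
  have : range q (q j) by exists j.
  by rewrite qS.
rewrite -[d.+1](eqP freeq); apply/mxrankS/row_subP => j; rewrite rowK.
have : convex_hull (range p) (q j) by apply: SP; rewrite -qS; exists j.
apply: (@convex_hull_sub _ _ _ [set x | (homog x <= homogenization p)%MS]).
  apply/convex_setP => x y t _ _ /= xp yp.
  have -> : homog (t *: x + (1 - t) *: y) = t *: homog x + (1 - t) *: homog y.
    rewrite /homog !scale_row_mx add_row_mx -scalerDl; congr row_mx.
    by rewrite addrC subrK scale1r.
  by rewrite addmx_sub // scalemx_sub.
by move=> _ [i _ <-] /=; rewrite -[homog _](rowK (fun i => homog (p i))) row_sub.
Qed.

Lemma simplex_of_row_free (R : realType) d n (p : 'I_n -> 'rV[R]_d) :
  injective p -> row_free (homogenization p) ->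
  is_simplex (convex_hull (range p)).
Proof.
move=> injp freep; pose S := [fset p i | i in 'I_n]%fset.
have sumS (V : lmodType R) (h : 'rV[R]_d -> V) :
    \sum_(x <- S) h x = \sum_i h (p i).
  by rewrite big_imfset /= ?big_enum // => i j _ _ /injp.
exists S; split=> [w w0 wp0 x xS|].
  have c0 : (\row_i w (p i)) = 0.
    apply: (row_free_inj freep); rewrite mul0mx; apply/dependencyP.
    split; [rewrite -[RHS]w0 (sumS R^o) | rewrite -[RHS]wp0 sumS];
      by apply: eq_bigr => i _; rewrite mxE.
  have /imfsetP[i _ ->] := xS.
  by have /rowP/(_ i) := c0; rewrite !mxE.
congr convex_hull; apply/seteqP; split=> [_ [i _ <-]|_ /imfsetP[i _ ->]].
  exact: in_imfset.
by exists i.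
Qed.

(** * Empty simplices as minimal negative supports *)

(** The polytope is given by the family [p] of its vertices, so that sets of
    vertices become sets of indices and dependencies become row vectors. *)
Section SimplicialPolytope.
Context (R : realType) (d n : nat) (P : set 'rV[R]_d) (p : 'I_n -> 'rV[R]_d).
Context (injp : injective p) (Pp : P = convex_hull (range p)).
Context (Pvert : vertices P = range p).
Context (Psimp : forall F, is_face P F -> F <> P -> is_simplex F).

Lemma face_vertexP F i : is_face P F -> F (p i) <-> vertices F (p i).
Proof.
move=> fF; split; last exact: vertices_sub.
by apply: vertices_of_face fF _; rewrite Pvert; exists i.
Qed.

(** Pairing a dependency with a functional exposing [F] shows that it is
    supported on the vertices of [F]; these are affinely independent because
    [F] is a simplex. *)
Lemma proper_face_no_dependency F (c : 'rV[R]_n) :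
  is_face P F -> F <> P -> c *m homogenization p = 0 ->
  (forall i, ~ F (p i) -> 0 <= c 0 i) -> c = 0.
Proof.
move=> fF FP /dependencyP[c0 cp0] cge.
have [S0 [indS0 FS0]] := Psimp fF FP.
have cF i : c 0 i != 0 -> F (p i).
  have [l [b [lb FE]]] := fF.
  have Ppi j : P (p j) by rewrite Pp; apply: sub_convex_hull; exists j.
  move=> ci; rewrite FE; split=> //.
  apply: tight_support (ci); last by rewrite cp0 c0 linear0 mulr0.
  move=> j _; have [|Fj] := pselect (F (p j)).
    by rewrite {1}FE => -[_ ->]; rewrite subrr mulr0.
  by rewrite mulr_ge0 ?cge // subr_ge0 lb.
apply/rowP => i; rewrite mxE.
apply: (affinely_independent_dependency injp indS0) c0 cp0 i => i /cF.
by move=> /(face_vertexP _ fF); rewrite {1}FS0 => /simplex_vertices.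
Qed.

Definition vertex_index (S : {fset 'rV[R]_d}) : {set 'I_n} :=
  finset (fun i => p i \in S).

Lemma face_vertex_set_of_covector (S : {fset 'rV[R]_d}) (y : 'cV[R]_(1 + d)) :
  [set` S] `<=` vertices P ->
  (forall i, if i \in vertex_index S then (homogenization p *m y) i 0 = 0
             else 0 < (homogenization p *m y) i 0) ->
  is_face_vertex_set P S.
Proof.
move=> SP yP; have y0 j : 0 <= (homogenization p *m y) j 0.
  by have := yP j; case: ifP => [_ ->//|_ /ltW].
have := covector_face y0; rewrite -Pp; set F := [set x | _] => fF.
have FS i : F (p i) <-> p i \in S.
  rewrite /F /= -homogenization_mul; have := yP i; rewrite inE.
  case: ifP => [_ y_i|_ y_i]; split=> //.
    by move=> _; split=> //; rewrite Pp; apply: sub_convex_hull; exists i.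
  by move=> [_ y_i0]; rewrite y_i0 ltxx in y_i.
exists F; split=> //; apply/seteqP; split=> v.
  move=> /[dup] /vertices_sub Fv; have := fF; rewrite Pp.
  by move=> /vertices_face_sub_range /[apply] -[i _ vi]; move: Fv; rewrite -vi FS.
move=> /= /[dup] /SP; rewrite Pvert => -[i _ <-] /FS.
by move/(face_vertexP _ fF).
Qed.

Lemma empty_simplex_dependency S :
  empty_simplex P S -> exists c : 'rV[R]_n,
    [/\ c *m homogenization p = 0, c != 0 &
        forall i, i \notin vertex_index S -> 0 <= c 0 i].
Proof.
move=> [SP nface _].
have [[y yP]|[c [cA cge [i _ ci]]]] :=
  stiemke_support (homogenization p) (vertex_index S).
  by case: nface; apply: face_vertex_set_of_covector yP.
exists c; split=> //; apply: contraTneq ci => ->; by rewrite mxE ltxx.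
Qed.

(** If [c] were nonnegative at some [i] in [S], it would be nonnegative off
    [S] minus [p i], which is a proper face. *)
Lemma empty_simplex_negative S (c : 'rV[R]_n) :
  empty_simplex P S -> c *m homogenization p = 0 -> c != 0 ->
  (forall i, i \notin vertex_index S -> 0 <= c 0 i) ->
  forall i, i \in vertex_index S -> c 0 i < 0.
Proof.
move=> [SP _ bdS] cA c0 cge i; rewrite inE => iS; rewrite ltNge; apply/negP => ci.
have [F [fF FS]] := bdS _ (fproperD1 iS).
have FP : F <> P.
  move=> FE; have : range p (p i) by exists i.
  by rewrite -Pvert -FE FS /= !inE eqxx.
move/eqP: c0; apply; apply: (proper_face_no_dependency fF FP cA) => j.
move=> /(face_vertexP _ fF); rewrite FS /= !inE => /negP.
rewrite negb_and negbK => /orP[/eqP/injp ->//|jS].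
by apply: cge; rewrite inE.
Qed.

(** Start from a dependency that is nonnegative off [S] and shrink its zero set
    [Z] off [S].  Either some dependency is nonnegative on [Z] and positive
    somewhere there, and a small multiple of it can be added; or the
    complement of [Z] is exposed as a proper face carrying the dependency,
    which is impossible. *)
Lemma empty_simplex_interior_dependency S :
  empty_simplex P S -> exists c : 'rV[R]_n,
    c *m homogenization p = 0 /\ forall i, i \notin vertex_index S -> 0 < c 0 i.
Proof.
move=> /empty_simplex_dependency; move: (vertex_index S) => I.
pose Z (c : 'rV[R]_n) := finset (fun i => (i \notin I) && (c 0 i == 0)).
move=> [c [cA c0 cge]]; have [k] := ubnP #|Z c|.
elim: k => // k IH in c cA c0 cge *; rewrite ltnS => leZ.
have [Z0|[i0 i0Z]] := set_0Vmem (Z c).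
  exists c; split=> // i iI; rewrite lt_neqAle cge // andbT eq_sym.
  by move/setP/(_ i): Z0; rewrite !inE iI => /negbT.
have [[y yP]|[m [mA mge [i1 i1Z mi1]]]] :=
  stiemke_support (homogenization p) (~: Z c).
  have y0 j : 0 <= (homogenization p *m y) j 0.
    by have := yP j; case: ifP => [_ ->//|_ /ltW].
  have := covector_face y0; rewrite -Pp; set F := [set x | _] => fF.
  have FP : F <> P.
    have Pi : P (p i0) by rewrite Pp; apply: sub_convex_hull; exists i0.
    move=> FE; have : F (p i0) by rewrite FE.
    rewrite /F /= -homogenization_mul => -[_ yi0].
    by have := yP i0; rewrite inE i0Z yi0 ltxx.
  case/eqP: c0; apply: (proper_face_no_dependency fF FP cA) => j Fj.
  have [jZ|jZ] := boolP (j \in Z c); first by move: jZ; rewrite inE => /andP[_ /eqP ->].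
  case: Fj; rewrite /F /= -homogenization_mul; have := yP j; rewrite inE jZ.
  by move=> ->; split=> //; rewrite Pp; apply: sub_convex_hull; exists j.
have [e [e0 _ eP]] := @small_step R _ [pred i | (i \notin I) && (0 < c 0 i)]
  (c 0) (m 0) (fun i Hi => proj2 (andP Hi)).
have ccoord i : (c + e *: m) 0 i = c 0 i + e * m 0 i by rewrite !mxE.
have onZ i : i \notin I -> i \notin Z c -> 0 < (c + e *: m) 0 i.
  move=> iI; rewrite inE iI /= => ci; rewrite ccoord; apply: eP => /=.
  by rewrite iI lt_neqAle eq_sym ci cge.
move: i1Z; rewrite inE negbK => i1Z.
have /andP[i1I /eqP ci1] : (i1 \notin I) && (c 0 i1 == 0) by rewrite inE in i1Z.
have pos1 : 0 < (c + e *: m) 0 i1 by rewrite ccoord ci1 add0r mulr_gt0.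
apply: (IH (c + e *: m)).
- by rewrite mulmxDl cA add0r -scalemxAl mA scaler0.
- by apply: contraTneq pos1 => ->; rewrite mxE ltxx.
- move=> i iI; have [iZ|iZ] := boolP (i \in Z c); last exact/ltW/onZ.
  rewrite ccoord; move: (iZ); rewrite inE => /andP[_ /eqP ->]; rewrite add0r.
  by rewrite mulr_ge0 ?(ltW e0) // mge // inE negbK.
- apply: leq_trans leZ; apply: proper_card; apply/properP; split.
    apply/fintype.subsetP => i; rewrite [in X in X -> _]inE => /andP[iI /eqP ci].
    by apply: contraT => /(onZ _ iI); rewrite ci ltxx.
  by exists i1 => //; rewrite inE negb_and gt_eqF ?orbT.
Qed.

End SimplicialPolytope.

(** * Counting empty simplices *)

Lemma row_basis (F : fieldType) m n r (M : 'M[F]_(m, n)) :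
  \rank M = r -> exists B : 'M[F]_(r, n), (B :=: M)%MS.
Proof. by move=> <-; exists (row_base M); apply: eq_row_base. Qed.

Lemma card_le_finset (T : Type) (I : finType) (A : set T) (h : T -> I)
    (D : {set I}) N :
  {in A &, injective h} -> (forall x, A x -> h x \in D) -> (#|D| <= N)%N ->
  A #<= `I_N.
Proof.
move=> injh hD leN; pose f x := index (h x) (enum D).
have injf : {in A &, injective f}.
  move=> x y xA yA fxy; apply: injh => //.
  have hE z : z \in A -> nth (h x) (enum D) (f z) = h z.
    by rewrite inE => /hD Dz; rewrite nth_index ?mem_enum.
  by rewrite -[LHS]hE // -[RHS]hE // fxy.
rewrite -(card_le_eql (inj_card_eq injf)); apply: subset_card_le.
move=> _ [x Ax <-] /=; apply: leq_trans leN.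
by rewrite cardE index_mem mem_enum hD.
Qed.

Theorem corollary4p16 (R : realType) (d : nat) (P : set 'rV[R]_d) (f0 : nat)
    (hP : simplicial_polytope P) (hns : ~ is_simplex P)
    (hf0 : vertices P #= `I_f0) (k : nat) (hk : (1 <= k)%N) :
  let g1 := (f0 - d - 1)%N in
  [set S : {fset 'rV[R]_d} | empty_simplex P S /\ (#|` S| - 1 <= k)%N]
    #<= `I_('C(g1 + k, g1 - 1) + 'C(g1 + k - 1, g1 - 1))%N.
Proof.
move: hP => [polP dimP simpP].
have [n [p [injp Pp Pvert]]] := polytope_vertices polP.
have rankA : \rank (homogenization p) = d.+1.
  by apply: rank_homogenization; rewrite -Pp.
have nf0 : n = f0.
  apply/card_eq_II; apply: card_eq_trans hf0.
  rewrite Pvert; apply: card_eq_trans card_II _.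
  by rewrite card_eq_sym; apply: inj_card_eq => i j _ _ /injp.
have [g gE] : exists g, (n - d.+1 = g.+1)%N.
  suff : (d.+1 < n)%N by rewrite -subn_gt0; case: (_ - _)%N => // g _; exists g.
  rewrite -rankA ltn_neqAle rank_leq_row andbT; apply/negP => freep.
  by apply: hns; rewrite Pp; apply: simplex_of_row_free.
cbv zeta; have -> : (f0 - d - 1)%N = g.+1 by rewrite -nf0 -subnDA addn1 gE.
have [B BA] : exists B : 'M[R]_(g.+1, n), (B :=: kermx (homogenization p))%MS.
  by apply: row_basis; rewrite mxrank_ker rankA.
have BP (c : 'rV[R]_n) : c *m homogenization p = 0 <-> exists x, c = x *m B.
  split=> [/eqP|[x ->]]; first by rewrite -sub_kermx -BA => /submxP.
  by apply/eqP; rewrite -sub_kermx -BA submxMl.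
have i0 : 'I_n by move: gE; case: (n) => // m _; exact: ord0.
set EP := [set S | _].
pose D := finset (fun I => `[< exists2 S, EP S & vertex_index p S = I >]).
have DP I : I \in D -> exists2 S, EP S & vertex_index p S = I.
  by rewrite inE => /asboolP.
have cardD I : I \in D -> (#|I| <= k.+1)%N.
  case/DP=> S [_ cardS] <-; apply: leq_trans (_ : (#|` S| <= _)%N); last first.
    by move: cardS; rewrite leq_subLR.
  rewrite cardE -(size_map p); apply: uniq_leq_size.
    by rewrite map_inj_uniq ?enum_uniq.
  by move=> _ /mapP[i + ->]; rewrite mem_enum inE.
(* the dependencies of the slice c_i0 = c are nonzero, so minimality applies *)
have negD I (x : 'rV_g.+1) (c : R) : I \in D -> c != 0 -> (x *m B) 0 i0 = c ->
    (forall i, i \notin I -> 0 <= (x *m B) 0 i) ->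
    forall i, i \in I -> (x *m B) 0 i < 0.
  case/DP=> S [emptyS _] <- cn0 xi0.
  apply: (empty_simplex_negative injp Pp Pvert simpP emptyS).
    by apply/BP; exists x.
  by apply: contra_neq cn0 => x0; rewrite -xi0 x0 mxE.
(* a dependency with the right sign at i0 is scaled into the slice c_i0 = a *)
have exD (I : {set 'I_n}) (a : R) (c : 'rV[R]_n) : c *m homogenization p = 0 ->
    0 < a * c 0 i0 -> (forall i, i \notin I -> 0 <= c 0 i) -> `|a| = 1 ->
    exists x : 'rV_g.+1,
      (x *m B) 0 i0 = a /\ forall i, i \notin I -> 0 <= (x *m B) 0 i.
  move=> /BP[x ->] aci cge a1; have cn0 : (x *m B) 0 i0 != 0.
    by apply: contraTneq aci => ->; rewrite mulr0 ltxx.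
  exists (`|(x *m B) 0 i0|^-1 *: x); rewrite -scalemxAl; split=> [|i iI].
    rewrite mxE; apply: (mulfI (lt0r_neq0 aci)).
    have aa : a * a = 1 by rewrite -expr2 -real_normK ?num_real // a1 expr1n.
    have -> : `|(x *m B) 0 i0| = a * (x *m B) 0 i0.
      by rewrite -[RHS]gtr0_norm // normrM a1 mul1r.
    by rewrite mulrA mulfV ?lt0r_neq0 // mul1r mulrAC aa mul1r.
  by rewrite mxE mulr_ge0 ?invr_ge0 ?cge.
have card1 (I : {set 'I_n}) : (#|I| = (i0 \in I) + #|I :\ i0|)%N by exact: cardsD1.
have leD1 : (#|[set I in D | i0 \notin I]%SET| <= 'C(k.+1 + g, k.+1))%N.
  apply: (@card_minimal_negative_supports _ _ _ _ B i0 1) => [|I|I|I].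
  - exact: oner_neq0.
  - rewrite inE => /andP[/cardD + /negPf i0I]; by rewrite card1 i0I.
  - rewrite inE => /andP[/DP[S [emptyS _] SI] i0I].
    have [c [cA cpos]] :=
      empty_simplex_interior_dependency injp Pp Pvert simpP emptyS.
    rewrite SI in cpos; apply: (exD I _ c) => // [|i /cpos/ltW //|].
      by rewrite mul1r cpos.
    by rewrite normr1.
  - by rewrite inE => /andP[ID _] x; apply: negD; rewrite ?oner_neq0.
have leD2 : (#|[set I in D | i0 \in I]%SET| <= 'C(k + g, k))%N.
  apply: (@card_minimal_negative_supports _ _ _ _ B i0 (-1)) => [|I|I|I].
  - by rewrite oppr_eq0 oner_neq0.
  - by rewrite inE => /andP[/cardD + i0I]; rewrite card1 i0I.
  - rewrite inE => /andP[/DP[S [emptyS _] SI] i0I].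
    have [c [cA cn0 cge]] := empty_simplex_dependency Pp Pvert emptyS.
    have := empty_simplex_negative injp Pp Pvert simpP emptyS cA cn0 cge.
    rewrite SI in cge * => cneg; apply: (exD I _ c) => //.
      by rewrite mulN1r oppr_gt0 cneg.
    by rewrite normrN1.
  - by rewrite inE => /andP[ID _] x; apply: negD; rewrite ?oppr_eq0 ?oner_neq0.
apply: (@card_le_finset _ _ EP (vertex_index p) D).
- move=> S T; rewrite !inE => -[[SP _ _] _] [[TP _ _] _] ST.
  suff sub (S' T' : {fset 'rV[R]_d}) : [set` S'] `<=` vertices P ->
      vertex_index p S' = vertex_index p T' -> (S' `<=` T')%fset.
    by apply/eqP; rewrite finmap.eqEfsubset !sub.
  move=> S'P E; apply/fsubsetP => v /[dup] vS /S'P; rewrite Pvert => -[i _ vi].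
  by move/setP/(_ i): E; rewrite !inE vi vS.
- by move=> S ES; rewrite inE; apply/asboolP; exists S.
rewrite subn1 /= addSn subn1 /= -(cardsID [set I : {set 'I_n} | i0 \notin I]%SET D).
apply: leq_add.
  rewrite -[X in 'C(X, _)]/(g + k).+1 -addnS addnC -bin_sub ?leq_addl // addnK.
  by apply: leq_trans leD1; rewrite eq_leq //; apply: eq_card => I; rewrite !inE.
rewrite addnC -bin_sub ?leq_addl // addnK.
apply: leq_trans leD2; rewrite eq_leq //; apply: eq_card => I.
by rewrite !inE negbK andbC.
Qed.
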